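(* Fix $k\in\mathbb{N}_0$ and let $n=n(d)\geq d$ be an integer sequence. For each $d$ let $C_n^B\subseteq\mathbb{R}^d$ be the positive hull of a random walk with $n=n(d)$ steps in $\mathbb{R}^d$, as defined in the context. If $n(d)\leq e^{d/((k+\frac12)e)}$ for all sufficiently large $d$ (with $e$ Euler's number), then the random cone $C_n^B$ is $k$-neighbourly (i.e. $f_k(C_n^B)=\binom nk$) with probability converging to $1$ as $d\to\infty$; more precisely, as $d\to\infty$, $$\mathbb{P}\left[f_k(C_n^B)=\binom nk\right]=1-O\left(n^{-\frac12}\right).$$
   Context: $\mathbb{N}_0=\{0,1,2,\ldots\}$. For given $d$ and $n\ge d$, let $\xi_1,\ldots,\xi_n$ be i.i.d. random vectors in $\mathbb{R}^d$ whose distribution is absolutely continuous (with respect to Lebesgue measure) and centrally symmetric (i.e. $\xi_1$ and $-\xi_1$ have the same law). Put $S_i=\xi_1+\cdots+\xi_i$ for $1\le i\le n$. The random polyhedral cone $C_n^B$ is $$C_n^B=\mathrm{pos}\{S_1,\ldots,S_n\}=\{\lambda_1S_1+\cdots+\lambda_nS_n:\lambda_1,\ldots,\lambda_n\geq0\}\subseteq\mathbb{R}^d.$$ For a polyhedral cone $C$, $f_k(C)$ denotes the number of $k$-dimensional faces of $C$. In particular, if $C=\mathbb{R}^d$, then the only face is $C$ itself, so $f_k(C)=0$ for $k<d$; if $C$ is pointed, then $\{0\}$ is its unique $0$-dimensional face. The following known formula may be used as a given: for all $k\in\{0,\ldots,d-1\}$ and $n\geq d$, $$\mathbb{E}[f_k(C_n^B)]=\frac{2\cdot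 k!}{n!}\sum_{l=0}^\infty\genfrac{[}{]}{0pt}{}{n}{d-2l-1}_{1/2}\genfrac{\{}{\}}{0pt}{}{d-2l-1}{k}_{1/2}.$$ Here, with $\genfrac{[}{]}{0pt}{}{n}{k}$, $\genfrac{\{}{\}}{0pt}{}{n}{k}$ the unsigned Stirling numbers of the first and second kind, the $r$-Stirling numbers for real $r$ are $\genfrac{[}{]}{0pt}{}{n}{k}_r=\sum_{j=k}^n\genfrac{[}{]}{0pt}{}{n}{j}\binom jk r^{j-k}$ and $\genfrac{\{}{\}}{0pt}{}{n}{k}_r=\sum_{j=k}^n\binom nj\genfrac{\{}{\}}{0pt}{}{j}{k}r^{n-j}$ for $0\le k\le n$; they are $0$ for $k<0$ or $k>n$, and terms with a negative upper or lower index $d-2l-1$ are $0$. *)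

(* Defs.v *)
From HB Require Import structures.
From mathcomp Require Import all_boot all_order all_algebra.
From mathcomp Require Import finmap.
From mathcomp Require Import all_classical all_reals all_analysis.

Set Implicit Arguments.
Unset Strict Implicit.
Unset Printing Implicit Defensive.

Import Order.TTheory GRing.Theory Num.Theory.
Import numFieldNormedType.Exports.

Local Open Scope classical_set_scope.
Local Open Scope ring_scope.

(* Unsigned Stirling numbers of the first and second kind, by their usual
   triangular recurrences. *)
Fixpoint stirling1 (n k : nat) : nat :=
  match n, k with
  | 0, 0 => 1
  | 0, _.+1 => 0
  | _.+1, 0 => 0
  | n'.+1, k'.+1 => n' * stirling1 n' k + stirling1 n' k'
  end%N.

Fixpoint stirling2 (n k : nat) : nat :=
  match n, k with
  | 0, 0 => 1
  | 0, _.+1 => 0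
  | _.+1, 0 => 0
  | n'.+1, k'.+1 => k * stirling2 n' k + stirling2 n' k'
  end%N.

Definition rstirling1 (R : realType) (r : R) (n k : nat) : R :=
  \sum_(k <= j < n.+1) (stirling1 n j)%:R * 'C(j, k)%:R * r ^+ (j - k).

Definition rstirling2 (R : realType) (r : R) (n k : nat) : R :=
  \sum_(k <= j < n.+1) 'C(n, j)%:R * (stirling2 j k)%:R * r ^+ (n - j).

Section cones.
Context {R : realType} {d : nat}.
Implicit Types C F : set 'rV[R]_d.

Definition pos_hull (n : nat) (v : 'I_n -> 'rV[R]_d) : set 'rV[R]_d :=
  [set x | exists2 l : 'I_n -> R,
     (forall i, 0 <= l i) & x = \sum_i l i *: v i].

(* The linear form u = 0 is allowed, so that C is a face of itself. *)
Definition is_face C F :=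
  exists2 u : 'cV[R]_d,
    (forall x, C x -> (x *m u) 0 0 <= 0) &
    F = C `&` [set x | (x *m u) 0 0 = 0].

(* [linear_hull F U] : U is the smallest linear subspace containing F. *)
Definition linear_hull F (U : {vspace 'rV[R]_d}) :=
  (forall x, F x -> x \in U) /\
  (forall W : {vspace 'rV[R]_d}, (forall x, F x -> x \in W) -> (U <= W)%VS).

Definition has_dim F (k : nat) :=
  exists2 U : {vspace 'rV[R]_d}, linear_hull F U & \dim U = k.

(* [fset_set] sends infinite sets to the empty one; polyhedral cones have
   finitely many faces. *)
Definition num_faces (k : nat) C : nat :=
  #|` fset_set [set F | is_face C F /\ has_dim F k]|.

End cones.

(* Vectors of R^d on the probabilistic side are tuples, whose sigma-algebra is
   the product of the Borel ones. *)
Definition rV_of_tuple (R : realType) (d : nat) (x : d.-tuple R) : 'rV[R]_d :=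
  \row_i tnth x i.

Definition opp_tuple (R : realType) (d : nat) (x : d.-tuple R) : d.-tuple R :=
  [tuple - tnth x i | i < d].

(* d-dimensional Lebesgue measure, as the d-fold product of the
   one-dimensional one. *)
Fixpoint lebesgue_tuple (R : realType) (d : nat) : set (d.-tuple R) -> \bar R :=
  match d return set (d.-tuple R) -> \bar R with
  | 0 => \d_([tuple] : 0.-tuple R)
  | d'.+1 => pushforward (lebesgue_measure \x @lebesgue_tuple R d')%E
               (fun xt => [tuple of xt.1 :: xt.2])
  end.

Section walks.
Context {R : realType} {disp : measure_display} {T : measurableType disp}.
Context {P : probability T R} {d n : nat}.
Implicit Types xi : 'I_n -> {RV P >-> d.-tuple R}.

Definition mutually_independent xi :=
  forall (J : {set 'I_n}) (B : 'I_n -> set (d.-tuple R)),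
    (forall i, measurable (B i)) ->
    P (\bigcap_(i in [set` J]) (xi i @^-1` B i)) =
    (\prod_(i in J) P (xi i @^-1` B i))%E.

Definition identically_distributed xi :=
  forall (i j : 'I_n) (B : set (d.-tuple R)), measurable B ->
    distribution P (xi i) B = distribution P (xi j) B.

Definition absolutely_continuous (X : {RV P >-> d.-tuple R}) :=
  distribution P X `<< @lebesgue_tuple R d.

Definition centrally_symmetric (X : {RV P >-> d.-tuple R}) :=
  forall B : set (d.-tuple R), measurable B ->
    distribution P X (@opp_tuple R d @^-1` B) = distribution P X B.

Definition walk_steps xi :=
  [/\ mutually_independent xi, identically_distributed xi,
      forall i, absolutely_continuous (xi i) &
      forall i, centrally_symmetric (xi i)].

(* Indices are shifted: [partial_sum xi i] is S_(i+1). *)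
Definition partial_sum xi (i : 'I_n) (w : T) : 'rV[R]_d :=
  \sum_(j < n | (j <= i)%N) rV_of_tuple (xi j w).

Definition walk_cone xi (w : T) : set 'rV[R]_d :=
  pos_hull (fun i => partial_sum xi i w).

Definition neighbourly_event (k : nat) xi : set T :=
  [set w | num_faces k (walk_cone xi w) = 'C(n, k)].

End walks.

(* The known formula for the expected face numbers; the summation over l stops
   where d - 2l - 1 becomes negative. *)
Definition expected_num_faces_formula (R : realType) : Prop :=
  forall (d n k : nat) (disp : measure_display) (T : measurableType disp)
         (P : probability T R) (xi : 'I_n -> {RV P >-> d.-tuple R}),
    (k < d)%N -> (d <= n)%N -> walk_steps xi ->
    'E_P[fun w => (num_faces k (walk_cone xi w))%:R]%E =
    ((2 * k`!%:R / n`!%:R) *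
     \sum_(l < d | (l.*2 < d)%N)
        rstirling1 2^-1 n (d - l.*2 - 1) * rstirling2 2^-1 (d - l.*2 - 1) k)%:E.

(* Main.v *)
(** Let t_m = [n, m]_(1/2) {m, k}_(1/2). Evaluating the linear form
    X^j |-> S(j, k) at products of linear factors gives k! sum_m t_m = n! C(n, k),
    and, for k < n, sum_m (-1)^m t_m = 0. So the t_m of each parity sum to
    n! C(n, k) / (2 k!), and the given formula yields
    C(n, k) - E f_k <= (2 k! / n!) sum_(m > d) t_m. As k! t_m <=
    [n, m]_(1/2) (k + 1/2)^m, an exponential moment bound with weight e^m, the
    generating function of [n, m]_(1/2) and the growth condition on n bound this
    by a multiple of n^(-1/2).

    A k-dimensional face of a cone with n generators is determined by any k
    generators spanning it linearly, so f_k <= C(n, k) holds surely, and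
    P(f_k <> C(n, k)) <= C(n, k) - E f_k. It remains to see that f_k is
    measurable: faces correspond to the sets of generators that some linear
    form u kills while being negative on the other generators, and u can be
    taken to be a rational point in measurable coordinates of an annihilator. *)

Require Import Defs.
From HB Require Import structures.
From mathcomp Require Import all_boot all_order all_algebra.
From mathcomp Require Import finmap ring.
From mathcomp Require Import all_classical all_reals all_analysis.
From mathcomp Require Import measurable_realfun measurable_fun_approximation.

Set Implicit Arguments.
Unset Strict Implicit.
Unset Printing Implicit Defensive.

Import Order.TTheory GRing.Theory Num.Theory.
Import numFieldNormedType.Exports.

Local Open Scope classical_set_scope.
Local Open Scope ring_scope.

(** * Stirling numbers *)

Lemma stirling2_small n k : (n < k)%N -> stirling2 n k = 0%N.
Proof.
elim: n k => [|n IH] [|k] //=; rewrite ltnS => nk.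
by rewrite !IH ?muln0 // ltnW.
Qed.

(** The recurrence of [stirling1] multiplies the rising factorial by [y + n]. The bound [N] is free
    since the two terms of the recurrence need different bounds. *)
Lemma sum_stirling1 (A : comNzRingType) (y : A) n N : (n < N)%N ->
  \sum_(j < N) y ^+ j *+ stirling1 n j = \prod_(i < n) (y + i%:R).
Proof.
elim: n N => [|n IH] [//|N] nN.
  by rewrite big_ord0 big_ord_recl /= big1 ?addr0 ?expr0 // => i _; rewrite mulr0n.
rewrite [in RHS]big_ord_recr /= big_ord_recl /= mulr0n add0r.
under eq_bigr => i _ do rewrite /bump /= add1n mulrnDr.
rewrite big_split /= mulrDr addrC; congr (_ + _).
  by rewrite -(IH N) // mulr_suml; apply: eq_bigr => i _; rewrite mulrnAl exprSr.
rewrite -(IH N.+1) 1?ltnW // big_ord_recl /= mulrDl.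
rewrite [X in X + _](_ : _ = 0); last first.
  by case: n {IH nN} => [|n]; rewrite ?mulr0 // mulr0n mul0r.
rewrite add0r mulr_suml; apply: eq_bigr => i _.
by rewrite /bump /= add1n mulrnA mulr_natr mulrnAC.
Qed.

(** Follows from [x * x ^_ i = x ^_ i.+1 + i * x ^_ i] and the recurrence of [stirling2]. *)
Lemma sum_stirling2_ffact j N x : (j < N)%N ->
  (\sum_(i < N) stirling2 j i * x ^_ i = x ^ j)%N.
Proof.
elim: j N => [|j IH] [//|N] jN.
  by rewrite big_ord_recl /= big1 // => i _; rewrite /bump add1n.
rewrite big_ord_recl /= mul0n add0n.
under eq_bigr => i _ do rewrite /bump /= add1n mulnDl.
rewrite big_split /=.
have E : (\sum_(i < N) i.+1 * stirling2 j i.+1 * x ^_ i.+1 =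
          \sum_(i < N) i * stirling2 j i * x ^_ i)%N.
  transitivity (\sum_(i < N.+1) i * stirling2 j i * x ^_ i)%N.
    by rewrite big_ord_recl /= add0n; apply: eq_bigr.
  by rewrite big_ord_recr /= stirling2_small // muln0 addn0.
rewrite E -big_split /= expnS -(IH N) // big_distrr /=.
apply: eq_bigr => i _; rewrite ffactnSr.
have [ix|xi] := leqP i x; last by rewrite ffact_small // !muln0.
rewrite [(x ^_ i * _)%N]mulnC mulnA -mulnDl mulnA.
by congr (_ * _)%N; rewrite [(i * _)%N]mulnC -mulnDr subnKC // mulnC.
Qed.

(** This keeps only the term [i = k] of the expansion of [k ^ j] into falling factorials. *)
Lemma leq_fact_stirling2 j k : (k`! * stirling2 j k <= k ^ j)%N.
Proof.
have [jk|kj] := ltnP j k; first by rewrite stirling2_small // muln0.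
rewrite -(@sum_stirling2_ffact j j.+1) // (bigD1 (inord k)) //=.
by rewrite inordK ?ltnS // ffactnn mulnC leq_addr.
Qed.

Lemma sum_nat_ord (V : nmodType) (F : nat -> V) k N :
  (forall j, (j < k)%N -> F j = 0) ->
  \sum_(k <= j < N) F j = \sum_(j < N) F j.
Proof.
move=> F0; have [kN|Nk] := leqP k N.
  rewrite -(big_mkord xpredT) (big_cat_nat (leq0n k) kN) /=.
  by rewrite [X in _ = X + _](_ : _ = 0) ?add0r // big_nat big1 // => i /andP[_ /F0].
rewrite big_geq 1?ltnW // big1 // => i _; apply: F0.
exact: ltn_trans Nk.
Qed.

(** * The Stirling linear form and sums of products of r-Stirling numbers *)

Section stirling_functional.
Variable R : realType.
Implicit Types (p q : {poly R}) (k : nat) (r : R).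

(* The linear form on polynomials mapping ['X^j] to S(j, k); in umbral terms
   [p |-> (Delta^k p)(0) / k!]. *)
Definition stirling_form k p : R :=
  \sum_(j < size p) p`_j * (stirling2 j k)%:R.

Lemma stirling_formE k p N : (size p <= N)%N ->
  stirling_form k p = \sum_(j < N) p`_j * (stirling2 j k)%:R.
Proof.
move=> pN; rewrite /stirling_form (big_ord_widen N (fun j => p`_j * (stirling2 j k)%:R)) //.
rewrite big_mkcond; apply: eq_bigr => i _.
by case: ltnP => // /(nth_default 0) ->; rewrite mul0r.
Qed.

Lemma stirling_form0 k : stirling_form k 0 = 0.
Proof. by rewrite /stirling_form size_poly0 big_ord0. Qed.

Lemma stirling_formD k p q :
  stirling_form k (p + q) = stirling_form k p + stirling_form k q.
Proof.
rewrite (stirling_formE _ (size_polyD p q)).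
rewrite (@stirling_formE _ p (maxn (size p) (size q))) ?leq_maxl //.
rewrite (@stirling_formE _ q (maxn (size p) (size q))) ?leq_maxr //.
by rewrite -big_split; apply: eq_bigr => i _; rewrite coefD mulrDl.
Qed.

Lemma stirling_formZ k (c : R) p :
  stirling_form k (c *: p) = c * stirling_form k p.
Proof.
rewrite (stirling_formE _ (size_scale_leq c p)) mulr_sumr.
by apply: eq_bigr => i _; rewrite coefZ mulrA.
Qed.

Lemma stirling_form_sum k (I : Type) (s : seq I) (P : pred I) (F : I -> {poly R}) :
  stirling_form k (\sum_(i <- s | P i) F i) =
  \sum_(i <- s | P i) stirling_form k (F i).
Proof.
exact: (big_morph _ (stirling_formD k) (stirling_form0 k)).
Qed.

Lemma stirling_formXn k j : stirling_form k 'X^j = (stirling2 j k)%:R.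
Proof.
rewrite (@stirling_formE k _ j.+1) ?size_polyXn // big_ord_recr /= coefXn eqxx mul1r.
by rewrite big1 ?add0r // => i _; rewrite coefXn ltn_eqF ?mul0r.
Qed.

Lemma stirling_form1 k : stirling_form k 1 = (k == 0%N)%:R.
Proof. by rewrite -(expr0 'X) stirling_formXn; case: k. Qed.

(** The recurrence of [stirling2], extended by linearity; both product evaluations below rest on
    it. *)
Lemma stirling_form_mulX k p :
  stirling_form k (p * 'X) =
  k%:R * stirling_form k p + (if k is k'.+1 then stirling_form k' p else 0).
Proof.
rewrite (@stirling_formE k (p * 'X) (size p).+1); last first.
  by have [->|p0] := eqVneq p 0; rewrite ?mul0r ?size_poly0 // size_mulX.
rewrite big_ord_recl coefMX mul0r add0r.
under eq_bigr => i _ do rewrite coefMX /=.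
case: k => [|k]; first by rewrite mul0r addr0 big1 // => i _; rewrite mulr0.
rewrite /stirling_form mulr_sumr -big_split; apply: eq_bigr => i _ /=.
by rewrite natrD natrM; ring.
Qed.

Lemma rstirling2_form r m k :
  rstirling2 r m k = stirling_form k (('X + r%:P) ^+ m).
Proof.
rewrite addrC exprDn stirling_form_sum /rstirling2 sum_nat_ord => [|j jk].
  apply: eq_bigr => i _.
  rewrite -[in RHS]scaler_nat -polyC_exp mul_polyC scalerA stirling_formZ.
  by rewrite stirling_formXn mulrAC.
by rewrite stirling2_small // mulr0 mul0r.
Qed.

(** Expand the rising factorial at [x + r] in powers, then each power binomially. Here [x] is a
    polynomial so that [stirling_form] can be applied afterwards. *)
Lemma sum_rstirling1 r (x : {poly R}) n :
  \sum_(m < n.+1) rstirling1 r n m *: x ^+ m =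
  \prod_(i < n) (x + (r + i%:R)%:P).
Proof.
under [RHS]eq_bigr => i _ do rewrite polyCD addrA polyC_natr.
rewrite -(sum_stirling1 _ (ltnSn n)).
under eq_bigr => m _.
  rewrite /rstirling1 sum_nat_ord => [|j jm]; last first.
    by rewrite bin_small // mulr0 mul0r.
  rewrite scaler_suml.
  over.
rewrite exchange_big; apply: eq_bigr => j _ /=.
rewrite addrC exprDn.
rewrite (big_ord_widen n.+1 (fun i => r%:P ^+ (j - i) * x ^+ i *+ 'C(j, i))) //.
rewrite [in RHS]big_mkcond -sumrMnl; apply: eq_bigr => m _.
case: ltnP => [_|jm]; last by rewrite bin_small // mulr0 mul0r scale0r mul0rn.
rewrite -mulrnA -[in RHS]scaler_nat -polyC_exp mul_polyC scalerA.
by congr (_ *: _); rewrite natrM; ring.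
Qed.

Lemma sum_rstirling1_real r (x : R) n :
  \sum_(m < n.+1) rstirling1 r n m * x ^+ m =
  \prod_(i < n) (x + r + i%:R).
Proof.
have /(congr1 (horner^~ 0)) := sum_rstirling1 r x%:P n.
rewrite /= horner_sum horner_prod => H.
transitivity (\sum_(m < n.+1) (rstirling1 r n m *: x%:P ^+ m).[0]).
  by apply: eq_bigr => m _; rewrite hornerZ -polyC_exp hornerC.
by rewrite H; apply: eq_bigr => i _; rewrite -polyCD hornerC addrA.
Qed.

(** The generating function at [c (X + r)], under the form: [c = 1] will give the full sum, [c = -1]
    the alternating one. *)
Lemma sum_rstirling12_form r k n (c : R) :
  \sum_(m < n.+1) rstirling1 r n m * (c ^+ m * rstirling2 r m k) =
  stirling_form k (\prod_(i < n) (c *: ('X + r%:P) + (r + i%:R)%:P)).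
Proof.
rewrite -sum_rstirling1 stirling_form_sum; apply: eq_bigr => m _.
by rewrite exprZn !stirling_formZ rstirling2_form.
Qed.

(** Umbrally, the product is [n! C(x + n, n)], whose k-th difference at 0 is [n! C(n, k)]. *)
Lemma rising_stirling_form k n :
  k`!%:R * stirling_form k (\prod_(i < n) ('X + i.+1%:R%:P)) =
  (n`! * 'C(n, k))%:R.
Proof.
elim: n k => [|n IH] k.
  rewrite big_ord0 stirling_form1 bin0n fact0 mul1n.
  by case: k => [|k]; rewrite ?mulr0 ?mulr1.
rewrite big_ord_recr /= mulrDr stirling_formD stirling_form_mulX.
rewrite [_ * _%:P]mulrC mul_polyC stirling_formZ.
case: k => [|k].
  rewrite mul0r !add0r fact0 mul1r.
  have := IH 0%N; rewrite fact0 mul1r !bin0 => ->.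
  by rewrite factS -natrM; congr (_%:R); rewrite mulnA.
have IHk := IH k; have IHk1 := IH k.+1.
set P := \prod_(i < n) _ in IHk IHk1 *.
transitivity ((n.+1 + k.+1)%:R * (n`! * 'C(n, k.+1))%:R +
              k.+1%:R * (n`! * 'C(n, k))%:R : R).
  by rewrite -IHk -IHk1 factS natrM natrD; ring.
rewrite -!natrM -natrD; congr (_%:R).
have := mul_bin_diag n.+1 k; rewrite /= factS binS => H.
by rewrite mulnDr [(n.+1 * _ * 'C(n, k))%N]mulnAC H; ring.
Qed.

(** Up to the sign [(-1)^n] the product is the n-th falling factorial, and the form reads off the
    coefficient of the k-th one. *)
Lemma falling_stirling_form k n :
  stirling_form k (\prod_(i < n) (i%:R%:P - 'X)) =
  (-1) ^+ k * (n == k)%:R.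
Proof.
elim: n k => [|n IH] k.
  by rewrite big_ord0 stirling_form1 eq_sym; case: k => [|k]; rewrite ?mulr0 ?mulr1.
rewrite big_ord_recr /= mulrBr -[- (_ * _)]scaleN1r stirling_formD stirling_formZ.
rewrite stirling_form_mulX [_ * _%:P]mulrC mul_polyC stirling_formZ IH.
case: k => [|k].
  by case: n {IH} => [|n] /=; ring.
rewrite IH eqSS; have [->|_] := eqVneq n k.+1.
  by rewrite gtn_eqF // mulr0 addr0 mulN1r subrr mulr0.
by rewrite !mulr0 !add0r exprS mulN1r mulN1r mulNr.
Qed.

(** With [c = 1] the two halves add up and the factors become [X + (i + 1)]. *)
Lemma sum_rstirling12 k n :
  k`!%:R * \sum_(m < n.+1) rstirling1 2^-1 n m * rstirling2 2^-1 m k =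
  (n`! * 'C(n, k))%:R :> R.
Proof.
rewrite -rising_stirling_form; congr (_ * _).
have := sum_rstirling12_form 2^-1 k n 1.
under eq_bigr => m _ do rewrite expr1n mul1r.
move=> ->; congr stirling_form; apply: eq_bigr => i _.
rewrite scale1r -addrA -polyCD; congr (_ + _%:P).
by rewrite -[i.+1%:R]natr1; field.
Qed.

(** With [c = -1] the two halves cancel and the factors become [i - X]. *)
Lemma sum_sign_rstirling12 k n : (k < n)%N ->
  \sum_(m < n.+1) (-1) ^+ m * (rstirling1 2^-1 n m * rstirling2 2^-1 m k) = 0 :> R.
Proof.
move=> kn; have := sum_rstirling12_form 2^-1 k n (-1).
have -> : \prod_(i < n) (-1 *: ('X + (2^-1 : R)%:P) + (2^-1 + i%:R)%:P) =
          \prod_(i < n) (i%:R%:P - 'X).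
  by apply: eq_bigr => i _; rewrite scaleN1r polyCD; ring.
rewrite falling_stirling_form gtn_eqF // mulr0 => H; rewrite -[RHS]H.
by apply: eq_bigr => m _; ring.
Qed.

Lemma rstirling1_ge0 r n m : 0 <= r -> 0 <= rstirling1 r n m.
Proof.
by move=> r0; apply: sumr_ge0 => j _; rewrite !mulr_ge0 ?exprn_ge0.
Qed.

Lemma rstirling2_ge0 r m k : 0 <= r -> 0 <= rstirling2 r m k.
Proof.
by move=> r0; apply: sumr_ge0 => j _; rewrite !mulr_ge0 ?exprn_ge0.
Qed.

(** Termwise comparison with the binomial expansion of [(k + r)^m]. *)
Lemma ler_fact_rstirling2 r m k : 0 <= r ->
  k`!%:R * rstirling2 r m k <= (k%:R + r) ^+ m.
Proof.
move=> r0; rewrite /rstirling2 sum_nat_ord => [|j jk]; last first.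
  by rewrite stirling2_small // mulr0 mul0r.
rewrite addrC exprDn mulr_sumr; apply: ler_sum => j _.
have -> : k`!%:R * ('C(m, j)%:R * (stirling2 j k)%:R * r ^+ (m - j)) =
          r ^+ (m - j) * ('C(m, j) * (k`! * stirling2 j k))%:R.
  by rewrite !natrM; ring.
have -> : r ^+ (m - j) * k%:R ^+ j *+ 'C(m, j) =
          r ^+ (m - j) * ('C(m, j) * k ^ j)%:R.
  by rewrite natrM natrX -mulr_natr; ring.
by rewrite ler_wpM2l ?exprn_ge0 // ler_nat leq_mul2l leq_fact_stirling2 orbT.
Qed.

End stirling_functional.

Lemma sum_alternate (V : nmodType) (F : nat -> V) d :
  \sum_(l < d | (l.*2 < d)%N) F (d - l.*2 - 1)%N =
  \sum_(m < d | odd m != odd d) F m.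
Proof.
elim/ltn_ind: d => -[|[|d]] IH; first by rewrite !big_ord0.
  by rewrite big_mkcond big_ord1 big_mkcond big_ord1.
(* From [d] to [d + 2]: [l = 0] gives the index [d + 1], the last [l] fails the guard, and the rest
   is the sum for [d]. *)
rewrite big_mkcond big_ord_recl big_ord_recr /=.
rewrite [X in _ + X](_ : _ = \sum_(l < d | (l.*2 < d)%N) F (d - l.*2 - 1)%N).
  rewrite IH // [RHS]big_mkcond 2!big_ord_recr /= negbK eqxx /= addr0.
  by rewrite -big_mkcond /= addrC subn1 /=; case: (odd d).
rewrite [RHS]big_mkcond /=.
have -> : ((bump 0 d).*2 < d.+2)%N = false.
  by rewrite /bump add1n doubleS !ltnS ltnNge -addnn leq_addr.
rewrite addr0; apply: eq_bigr => i _.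
by rewrite /bump add1n doubleS !ltnS !subSS.
Qed.

(** * The tail sum and its exponential moment bound *)

Section tail_bound.
Variable R : realType.

Lemma rstirling12_tail k n d : (k < n)%N -> (d <= n)%N ->
  'C(n, k)%:R - (2 * k`!%:R / n`!%:R) *
     \sum_(l < d | (l.*2 < d)%N)
        rstirling1 2^-1 n (d - l.*2 - 1) * rstirling2 2^-1 (d - l.*2 - 1) k <=
  2 / n`!%:R *
    \sum_(d.+1 <= m < n.+1) rstirling1 2^-1 n m * (k%:R + 2^-1) ^+ m :> R.
Proof.
move=> kn dn.
pose t m : R := rstirling1 2^-1 n m * rstirling2 2^-1 m k.
have t0 m : 0 <= t m.
  by rewrite mulr_ge0 ?rstirling1_ge0 ?rstirling2_ge0 ?invr_ge0.
rewrite (sum_alternate t).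
pose A := \sum_(0 <= m < n.+1 | odd m != odd d) t m.
have total : (2 * k`!%:R) * A = (n`! * 'C(n, k))%:R.
  rewrite -sum_rstirling12 [2 * _]mulrC -mulrA; congr (_ * _).
  (* The alternating sum is [(-1)^d (B - A)]; its vanishing makes [A] and [B] each half of the
     total. *)
  have := sum_sign_rstirling12 R kn.
  rewrite -(big_mkord xpredT (fun m => (-1) ^+ m * t m)) -(big_mkord xpredT t).
  rewrite (bigID (fun m => odd m != odd d)) /=.
  rewrite [X in _ -> _ = X](bigID (fun m => odd m != odd d)) /= -/A.
  set B := \sum_(_ <= i < _ | ~~ (odd i != odd d)) t i.
  rewrite (eq_bigr (fun m => - (-1) ^+ d * t m)) => [|m mo]; last first.
    by rewrite -/(t m) -signr_odd -[in RHS]signr_odd; move: mo;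
       case: (odd m); case: (odd d) => // _; rewrite ?opprK.
  rewrite -mulr_sumr -/A.
  rewrite (eq_bigr (fun m => (-1) ^+ d * t m)) => [|m]; last first.
    by rewrite negbK -/(t m) -signr_odd -[in RHS]signr_odd => /eqP ->.
  rewrite -mulr_sumr -/B mulNr addrC -mulrBr => /eqP.
  by rewrite mulf_eq0 signr_eq0 /= subr_eq0 => /eqP ->; rewrite mulr_natl.
have nf0 : n`!%:R != 0 :> R by rewrite pnatr_eq0 -lt0n fact_gt0.
have -> : 'C(n, k)%:R = (2 * k`!%:R / n`!%:R) * A.
  by rewrite mulrAC total natrM mulrAC divff // mul1r.
rewrite -mulrBr [2 * _ / _]mulrAC -[leLHS]mulrA ler_wpM2l ?mulr_ge0 ?invr_ge0 //.
rewrite -(big_mkord (fun m => odd m != odd d)).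
(* The terms below [d] cancel, and the term [m = d] drops out by parity. *)
rewrite /A (big_cat_nat (leq0n d) (leqW dn)) /= addrAC subrr add0r.
rewrite big_mkcond (big_ltn (_ : d < n.+1)%N) //= eqxx add0r mulr_sumr.
apply: ler_sum => m _; case: ifP => _.
  rewrite mulrCA ler_wpM2l ?rstirling1_ge0 ?invr_ge0 //.
  by rewrite ler_fact_rstirling2 ?invr_ge0.
by rewrite mulr0 mulr_ge0 ?rstirling1_ge0 ?exprn_ge0 ?addr_ge0 ?invr_ge0.
Qed.

(** After division by [n!], each factor [1 + a / m] with [m > 1] is at most [(m / (m - 1))^a], and
    these telescope to [n^a]; the first factor [1 + a] costs [e^a]. *)
Lemma prod_rising_le (a : R) n : 0 <= a -> (0 < n)%N ->
  \prod_(i < n) (a + i.+1%:R) <= n`!%:R * (expR a * n%:R `^ a).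
Proof.
move=> a0; case: n => // n _; elim: n => [|n IH].
  rewrite big_ord1 factS fact0 muln1 mul1r powR1 mulr1 addrC; exact: expR_ge1Dx.
rewrite big_ord_recr /= factS natrM.
have H : a + n.+2%:R <= n.+2%:R * (n.+2%:R / n.+1%:R) `^ a.
  rewrite -[leLHS](mulfVK (_ : n.+2%:R != 0)) // mulrC ler_wpM2l //.
  rewrite mulrDl divff // addrC.
  (* It remains to see [1 / m <= ln (m / (m - 1))] for [m = n + 2], which is
     [ln (1 - 1 / m) <= - 1 / m]. *)
  apply: le_trans (expR_ge1Dx _) _.
  rewrite /powR mulf_eq0 invr_eq0 !pnatr_eq0 /= ler_expR ler_wpM2l //.
  rewrite -[X in ln X]invrK lnV ?posrE ?invr_gt0 ?divr_gt0 // lerNr invf_div.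
  rewrite (_ : n.+1%:R / n.+2%:R = 1 + - n.+2%:R^-1); last first.
    by rewrite -[n.+2%:R]natr1; field.
  by apply: le_ln1Dx; rewrite ltrN2 invf_lt1 // ltr1n.
apply: le_trans (ler_pM _ _ IH H) _.
- by apply: prodr_ge0 => i _; rewrite addr_ge0.
- by rewrite addr_ge0.
have -> : n.+2%:R `^ a = n.+1%:R `^ a * (n.+2%:R / n.+1%:R) `^ a :> R.
  by rewrite -powRM ?divr_ge0 // mulrC divfK.
rewrite le_eqVlt; apply/orP; left; apply/eqP; ring.
Qed.

(* Chernoff bound: each term with m > d is multiplied by e^(m - d) >= 1. *)
Lemma rstirling1_tail_le k n d : (0 < n)%N ->
  n%:R <= expR (d%:R / ((k%:R + 2^-1) * expR 1)) :> R ->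
  2 / n`!%:R *
    \sum_(d.+1 <= m < n.+1) rstirling1 2^-1 n m * (k%:R + 2^-1) ^+ m <=
  2 * expR ((k%:R + 2^-1) * expR 1 - 2^-1) * n%:R `^ (- 2^-1) :> R.
Proof.
move=> n0 nd; set c := k%:R + 2^-1 in nd *; set s := c * expR 1.
have c0 : 0 < c by rewrite ltr_wpDl ?invr_gt0.
have s0 : 0 < s by rewrite mulr_gt0 ?expR_gt0.
have a0 : 0 <= s - 2^-1.
  rewrite subr_ge0 (@le_trans _ _ c) ?lerDr //.
  by rewrite ler_peMr ?(ltW c0) // ltW // expR_gt1.
have nf0 : 0 < n`!%:R :> R by rewrite ltr0n fact_gt0.
rewrite -!mulrA ler_pM2l // mulrC ler_pdivrMr //.
(* The generating function at [s] has factors [s + 1/2 + i]; writing them as [(s - 1/2) + (i + 1)]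
   produces the exponent [s - 1/2]. *)
apply: (@le_trans _ _ (expR (- d%:R) * \prod_(i < n) (s - 2^-1 + i.+1%:R))).
  rewrite (eq_bigr (fun i : 'I_n => s + 2^-1 + i%:R)) => [|i _]; last first.
    by rewrite -[i.+1%:R]natr1; field.
  rewrite -sum_rstirling1_real mulr_sumr.
  rewrite -(big_mkord xpredT
    (fun m => expR (- d%:R) * (rstirling1 2^-1 n m * s ^+ m))).
  have [dn|nd'] := leqP d n; last first.
    rewrite [leLHS]big_geq ?ltnS 1?ltnW //; apply: sumr_ge0 => m _.
    by rewrite !mulr_ge0 ?expR_ge0 ?rstirling1_ge0 ?exprn_ge0 ?invr_ge0 // ltW.
  rewrite [leRHS](big_cat_nat (leq0n d.+1)) //= -[leLHS]add0r lerD //.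
    apply: sumr_ge0 => m _.
    by rewrite !mulr_ge0 ?expR_ge0 ?rstirling1_ge0 ?exprn_ge0 ?invr_ge0 // ltW.
  rewrite big_nat [leRHS]big_nat; apply: ler_sum => m /andP[dm _].
  rewrite [leRHS]mulrCA ler_wpM2l ?rstirling1_ge0 ?invr_ge0 //.
  rewrite exprMn [leRHS]mulrCA ler_peMr ?exprn_ge0  ?(ltW c0) //.
  rewrite -expRM_natl mulr1 -expRD .
  by rewrite ltW // expR_gt1 addrC subr_gt0 ltr_nat.
(* The growth condition says [s ln n <= d]. *)
have : expR (- d%:R) <= n%:R `^ (- s).
  have nz : n%:R != 0 :> R by rewrite pnatr_eq0 -lt0n.
  rewrite /powR (negbTE nz) ler_expR mulNr lerN2 mulrC -ler_pdivlMr //.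
  by rewrite -[leRHS]expRK ler_ln ?posrE ?ltr0n ?expR_gt0.
move=> H; apply: le_trans (ler_pM _ _ H (prod_rising_le a0 n0)) _;
  rewrite ?expR_ge0 //.
  by apply: prodr_ge0 => i _; rewrite addr_ge0.
have -> : n%:R `^ (- 2^-1) = n%:R `^ (- s) * n%:R `^ (s - 2^-1) :> R.
  rewrite -powRD ?addKr //; apply/implyP => _.
  by rewrite pnatr_eq0 -lt0n.
rewrite le_eqVlt; apply/orP; left; apply/eqP; ring.
Qed.
End tail_bound.

(** * Faces of a polyhedral cone *)

Section faces.
Context {R : realType} {d n : nat}.
Variable v : 'I_n -> 'rV[R]_d.
Implicit Types (I J B Z N : {set 'I_n}) (k : nat).

(** One predicate with two uses: for [N] the complement of [Z], [Z] indexes a face; for [N] a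
    singleton, its vector lies outside the span of [Z]. *)
Definition separated Z N : Prop := exists u : 'cV[R]_d,
  (forall i, i \in Z -> (v i *m u) 0 0 = 0) /\
  (forall i, i \in N -> (v i *m u) 0 0 < 0).

Definition sub_cone I : set 'rV[R]_d :=
  [set x | exists2 l : 'I_n -> R,
     (forall i, 0 <= l i) & x = \sum_(i in I) l i *: v i].

Definition sub_span I : {vspace 'rV[R]_d} := <<[seq v i | i in I]>>%VS.

Lemma mem_sub_span I i : i \in I -> v i \in sub_span I.
Proof. by move=> iI; apply: memv_span; apply: map_f; rewrite mem_enum. Qed.

Lemma sub_span_leP I (W : {vspace 'rV[R]_d}) :
  reflect (forall i, i \in I -> v i \in W) (sub_span I <= W)%VS.
Proof.
apply: (iffP span_subvP) => [H i iI | H _ /mapP[i iI ->]].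
  by apply: H; apply: map_f; rewrite mem_enum.
by apply: H; rewrite -mem_enum.
Qed.

Lemma sub_spanS I J : I \subset J -> (sub_span I <= sub_span J)%VS.
Proof.
by move=> /fintype.subsetP IJ; apply/sub_span_leP => i /IJ; exact: mem_sub_span.
Qed.

Lemma dim_sub_span I : (\dim (sub_span I) <= #|I|)%N.
Proof. by rewrite (leq_trans (dim_span _)) // size_map -cardE. Qed.

Lemma sub_cone_mem I i : i \in I -> sub_cone I (v i).
Proof.
move=> iI; exists (fun j => (j == i)%:R) => [j|]; first by rewrite ler0n.
rewrite (bigD1 i) //= eqxx scale1r big1 ?addr0 // => j /andP[_ /negbTE ->].
by rewrite scale0r.
Qed.

Lemma linear_hull_sub_cone I : linear_hull (sub_cone I) (sub_span I).
Proof.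
split=> [_ [l _ ->] | W H].
  by apply: memv_suml => i iI; apply: memvZ; exact: mem_sub_span.
by apply/sub_span_leP => i iI; apply/H/sub_cone_mem.
Qed.

Lemma has_dim_sub_cone I k : has_dim (sub_cone I) k <-> \dim (sub_span I) = k.
Proof.
have [H1 H2] := linear_hull_sub_cone I.
split=> [[U [U1 U2] <-] | <-]; last by exists (sub_span I).
by congr (\dim _); apply/eqP; rewrite eqEsubv (U2 _ H1) (H2 _ U1).
Qed.

(** If [u] vanishes on a nonnegative combination, all its nonpositive summands vanish, so generators
    with a negative value have coefficient 0. *)
Lemma pos_hull_sub_cone (u : 'cV[R]_d) :
  (forall i, (v i *m u) 0 0 <= 0) ->
  pos_hull v `&` [set x | (x *m u) 0 0 = 0] =
  sub_cone [set i | (v i *m u) 0 0 == 0]%SET.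
Proof.
move=> u0; set I := [set i | _]%SET; apply/seteqP; split=> x.
  case=> -[l l0 ->]; rewrite /= mulmx_suml summxE => H.
  exists l => //; rewrite [LHS](bigID (mem I)) /=.
  rewrite [X in _ + X]big1 ?addr0 // => i; rewrite inE => iI.
  have : - ((l i *: v i) *m u) 0 0 = 0.
    apply: (@psumr_eq0P _ _ xpredT (fun i => - ((l i *: v i) *m u) 0 0)) => //.
      by move=> j _; rewrite -scalemxAl mxE oppr_ge0 mulr_ge0_le0.
    by rewrite sumrN H oppr0.
  rewrite -scalemxAl mxE => /eqP; rewrite oppr_eq0 mulf_eq0 (negbTE iI) orbF.
  by move=> /eqP ->; rewrite scale0r.
case=> l l0 ->; split.
  exists (fun i => if i \in I then l i else 0) => [i|]; first by case: ifP.
  rewrite big_mkcond; apply: eq_bigr => i _.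
  by case: ifP => // _; rewrite scale0r.
rewrite /= mulmx_suml summxE big1 // => i.
by rewrite inE => /eqP vi; rewrite -scalemxAl mxE vi mulr0.
Qed.

Lemma pos_hull_mem i : pos_hull v (v i).
Proof.
exists (fun j => (j == i)%:R) => [j|]; first by rewrite ler0n.
rewrite (bigD1 i) //= eqxx scale1r big1 ?addr0 // => j /negbTE ->.
by rewrite scale0r.
Qed.

Lemma is_face_sub_coneP (F : set 'rV[R]_d) :
  is_face (pos_hull v) F <-> exists2 I, separated I (~: I) & F = sub_cone I.
Proof.
split=> [[u u0 ->] | [I [u [uZ uN]] ->]].
  have vu i : (v i *m u) 0 0 <= 0 by apply/u0/pos_hull_mem.
  exists [set i | (v i *m u) 0 0 == 0]%SET; last exact: pos_hull_sub_cone.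
  exists u; split=> i; first by rewrite inE => /eqP.
  by rewrite !inE lt_neqAle vu andbT.
have vu i : (v i *m u) 0 0 <= 0.
  have [/uZ -> //|iI] := boolP (i \in I).
  by apply/ltW/uN; rewrite inE.
exists u => [_ [l l0 ->] |].
  rewrite mulmx_suml summxE sumr_le0 // => i _.
  by rewrite -scalemxAl mxE mulr_ge0_le0.
rewrite pos_hull_sub_cone //; congr sub_cone; apply/setP => i; rewrite inE.
have [/uZ -> //|iI] := boolP (i \in I); first by rewrite eqxx.
by rewrite lt_eqF // uN // inE.
Qed.

Lemma separated_notin_span Z N i : separated Z N -> i \in N ->
  v i \notin sub_span Z.
Proof.
move=> [u [uZ uN]] iN; apply/negP => vi.
have H x : x \in sub_span Z -> (x *m u) 0 0 = 0.
  move=> /coord_span ->; rewrite mulmx_suml summxE big1 // => j _.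
  rewrite -scalemxAl mxE.
  have /mapP[l lZ ->] : [seq v i | i in Z]`_j \in [seq v i | i in Z].
    by apply: mem_nth; rewrite size_map -cardE; exact: ltn_ord.
  by rewrite uZ ?mulr0 // -mem_enum.
by have := uN _ iN; rewrite H // ltxx.
Qed.

(** Subtracting the projection onto the span of [Z] kills that span but not [v i]; a coordinate that
    is nonzero at [v i] gives the form. *)
Lemma notin_span_separated Z i : v i \notin sub_span Z ->
  separated Z [set i].
Proof.
move=> vi; pose f := (\1 - projv (sub_span Z))%VF : 'End('rV[R]_d).
pose M := lin1_mx f.
have fM x : x *m M = f x by rewrite mul_rV_lin1.
have f0 x : x \in sub_span Z -> f x = 0.
  by move=> xZ; rewrite add_lfunE opp_lfunE id_lfunE projv_id // subrr.
have : f (v i) != 0.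
  apply: contra vi; rewrite add_lfunE opp_lfunE id_lfunE subr_eq0 => /eqP ->.
  exact: memv_proj.
move=> /rV0Pn[j fj].
have fj' x : (x *m col j M) 0 0 = f x 0 j by rewrite -fM colE mulmxA -colE mxE.
(* This scaling makes the value at [v i] minus a nonzero square. *)
pose c := - (f (v i)) 0 j.
exists (c *: col j M); split=> l.
  move=> lZ; by rewrite -scalemxAr mxE fj' f0 ?mem_sub_span // mxE mulr0.
rewrite inE => /eqP ->.
rewrite -scalemxAr mxE fj' /c mulNr oppr_lt0 -expr2.
by rewrite exprn_even_gt0.
Qed.

Lemma notin_spanP Z i : v i \notin sub_span Z <-> separated Z [set i].
Proof.
split; first exact: notin_span_separated.
by move=> /separated_notin_span; apply; rewrite inE.
Qed.

Lemma face_span_determines I : separated I (~: I) ->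
  I = [set i | v i \in sub_span I]%SET.
Proof.
move=> sI; apply/setP => i; rewrite inE.
have [/mem_sub_span -> //|iI] := boolP (i \in I).
by apply/esym/negbTE/(separated_notin_span sI); rewrite inE.
Qed.

(** Greedy selection: an index is kept only when its vector lies outside the span of those already
    kept. *)
Lemma sub_span_basis I :
  exists B, [/\ B \subset I, #|B| = \dim (sub_span I) & sub_span B = sub_span I].
Proof.
suff H (s : seq 'I_n) : uniq s -> exists t : seq 'I_n, [/\ uniq t, {subset t <= s},
    free (map v t) & (<<map v t>> = <<map v s>>)%VS].
  have [t [ut ts ft tE]] := H (enum I) (enum_uniq _).
  have E : sub_span [set i in t] = (<<map v t>>)%VS.
    apply: eq_span => x; apply/mapP/mapP => -[i it ->]; exists i => //;
      by move: it; rewrite mem_enum inE.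
  exists [set i in t]; rewrite E tE; split=> //.
    by apply/fintype.subsetP => i; rewrite inE => /ts; rewrite mem_enum.
  by rewrite cardsE (card_uniqP ut) -[sub_span I]tE (eqP ft) size_map.
elim: s => [|i s IH] /= us; first by exists [::]; split=> //; rewrite nil_free.
case/andP: us => nis us; have [t [ut ts ft tE]] := IH us.
have [vi|vi] := boolP (v i \in <<map v t>>%VS).
  exists t; split=> //; first by move=> j /ts; rewrite inE orbC => ->.
  rewrite span_cons -tE; apply/esym/addv_idPr.
  by rewrite -memvE.
exists (i :: t); split.
- by rewrite /= ut andbT; apply: contra nis => /ts.
- by move=> j; rewrite !inE => /orP[->//|/ts ->]; rewrite orbT.
- by rewrite /= free_cons vi.
- by rewrite /= !span_cons tE.
Qed.

(** [B] is a basis; independence and spanning are phrased through [separated], so that measurability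
    of that predicate carries over to the dimension. *)
Lemma dim_sub_spanP I k : \dim (sub_span I) = k <->
  exists B, [/\ B \subset I, #|B| = k,
    forall i, i \in B -> separated (B :\ i) [set i] &
    forall i, i \in I -> ~ separated B [set i]].
Proof.
split=> [<- | [B [BI <- Bfree Bspan]]].
  have [B [BI cB BE]] := sub_span_basis I; exists B; split=> // i iB.
    apply/notin_spanP/negP => vi.
    have : (sub_span I <= sub_span (B :\ i))%VS.
      rewrite -BE; apply/sub_span_leP => j jB.
      have [->//|ji] := eqVneq j i.
      by apply: mem_sub_span; rewrite !inE ji.
    move=> /dimvS; rewrite -cB leqNgt => /negP; apply.
    by rewrite (leq_ltn_trans (dim_sub_span _)) // [in ltnRHS](cardsD1 i) iB.
  by move=> /notin_spanP; rewrite BE mem_sub_span.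
have BE : sub_span B = sub_span I.
  apply/eqP; rewrite eqEsubv sub_spanS //=; apply/sub_span_leP => i iI.
  by apply: contrapT => /negP/notin_spanP; exact: Bspan.
rewrite -BE; have [B' [B'B <- B'E]] := sub_span_basis B.
suff -> : B' = B by [].
apply/eqP; rewrite finset.eqEsubset B'B /=; apply/fintype.subsetP => i iB.
apply: contrapT => /negP iB'; have /notin_spanP/negP := Bfree _ iB; apply.
have := mem_sub_span iB; rewrite -B'E; apply/subvP/sub_spanS.
apply/fintype.subsetP => j jB'; rewrite !inE (fintype.subsetP B'B _ jB') andbT.
by apply: contra iB' => /eqP <-.
Qed.

Definition faces k : {set {set 'I_n}} :=
  [set I | `[< separated I (~: I) /\ \dim (sub_span I) = k >]]%SET.

(** [sub_cone] is injective on [faces k], as a separating form recovers the index set. *)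
Lemma num_facesE k : num_faces k (pos_hull v) = #|faces k|.
Proof.
rewrite /num_faces.
have -> : [set F | is_face (pos_hull v) F /\ has_dim F k] =
          [set` [fset sub_cone I | I in faces k]%fset].
  apply/seteqP; split=> F /=.
    move=> [/is_face_sub_coneP[I sI ->] /has_dim_sub_cone dI].
    by apply/imfsetP; exists I => //=; rewrite inE; apply/asboolP.
  move=> /imfsetP[I /=]; rewrite inE => /asboolP[sI dI] ->.
  by split; [apply/is_face_sub_coneP; exists I|apply/has_dim_sub_cone].
rewrite set_fsetK card_in_imfset /=; first by rewrite cardE.
move=> I J IF JF E; move: IF JF; rewrite !finset.in_set.
move=> /asboolP[[u [uI uIN]] _] /asboolP[[w [wJ wJN]] _].
(* A generator indexed by [A] lies in the cone of [B], where [x] vanishes, whereas [x] is negative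
   on generators outside [B]. *)
have sub A B (x : 'cV[R]_d) : (forall i, i \in B -> (v i *m x) 0 0 = 0) ->
    (forall i, i \in ~: B -> (v i *m x) 0 0 < 0) -> sub_cone A = sub_cone B ->
    A \subset B.
  move=> xB xBN AB; apply/fintype.subsetP => i /sub_cone_mem; rewrite AB => -[l _ vi].
  apply: contrapT => /negP iB; have := xBN i; rewrite inE iB => /(_ isT).
  rewrite vi mulmx_suml summxE big1 ?ltxx // => j jB.
  by rewrite -scalemxAl mxE xB // mulr0.
apply/eqP; rewrite finset.eqEsubset; apply/andP.
split; [exact: sub wJ wJN E|exact: sub uI uIN (esym E)].
Qed.

(* A face is determined by its linear span, hence by any k of the vectors
   spanning it: no genericity is needed. *)
Lemma num_faces_le k : (num_faces k (pos_hull v) <= 'C(n, k))%N.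
Proof.
rewrite num_facesE -[n in 'C(n, _)]card_ord -card_draws.
(* A choice of [k] generators with the same span; the default is never taken on [faces k]. *)
pose f I := odflt finset.set0 [pick B : {set 'I_n} |
  [&& #|B| == k & sub_span B == sub_span I]].
have fP I : I \in faces k -> #|f I| = k /\ sub_span (f I) = sub_span I.
  rewrite inE => /asboolP[_ dI]; rewrite /f; case: pickP => [B /andP[/eqP ? /eqP ?] //|].
  have [B [_ cB BE]] := sub_span_basis I.
  by move=> /(_ B); rewrite cB dI BE !eqxx.
rewrite -(@card_in_imset _ _ f).
  by apply/subset_leq_card/fintype.subsetP => _ /imsetP[I /fP[cI _] ->]; rewrite inE cI.
move=> I J IF JF fIJ; have [_ EI] := fP _ IF; have [_ EJ] := fP _ JF.
move: IF JF; rewrite !finset.in_set => /asboolP[sI _] /asboolP[sJ _].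
by rewrite (face_span_determines sI) (face_span_determines sJ) -EI -EJ fIJ.
Qed.

End faces.

(** * Measurability of the face numbers *)

Section annihilator.
Context {R : realType} {d : nat}.
Implicit Types (s : seq 'rV[R]_d) (u y : 'cV[R]_d).

(* A Gram-Schmidt process without normalisation: the columns of [ann_mx s] span
   the annihilator of [s], and its entries depend measurably on those of [s]. *)
Fixpoint ann_mx s : 'M[R]_d :=
  if s is x :: s' then
    let A := ann_mx s' in let a := x *m A in let q := (a *m a^T) 0 0 in
    if q == 0 then A else A *m (q%:M - a^T *m a)
  else 1%:M.

Lemma mulmx_tr_eq0 (a : 'rV[R]_d) : (a *m a^T) 0 0 = 0 -> a = 0.
Proof.
rewrite mxE => H; apply/rowP => j; rewrite mxE.
have /eqP : a 0 j * a^T j 0 = 0.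
  apply: (psumr_eq0P _ H) => // i _; rewrite mxE -expr2; exact: sqr_ge0.
by rewrite mxE mulf_eq0 orbb => /eqP.
Qed.

(** Among the forms [A y], those killing [x] have [a y = 0]. The matrix [q - a^T a] maps into this
    kernel and acts on it as [q]; if [q = 0] then [a = 0], and [A] already kills [x]. *)
Lemma ann_mxP s u :
  (forall x, x \in s -> x *m u = 0) <-> exists y, u = ann_mx s *m y.
Proof.
elim: s u => [|x s IH] u /=.
  by split=> // _; exists u; rewrite mul1mx.
set A := ann_mx s in IH *; set a := x *m A.
split=> [H | [y ->] z].
  have [|y uE] := (IH u).1; first by move=> z zs; apply: H; rewrite inE zs orbT.
  case: ifPn => [_|q0]; first by exists y.
  have ay : a *m y = 0 by rewrite -mulmxA -uE H ?mem_head.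
  exists (((a *m a^T) 0 0)^-1 *: y).
  rewrite -mulmxA mulmxBl -(mulmxA a^T) mul_scalar_mx scalerA mulfV // scale1r.
  by rewrite -[a *m _]scalemxAr ay scaler0 mulmx0 subr0.
rewrite inE => /predU1P[->|zs]; last first.
  by case: ifPn => _; rewrite -?(mulmxA A); apply: (IH _).2 zs; eexists.
case: ifPn => [/eqP/mulmx_tr_eq0 a0|_]; first by rewrite mulmxA -/a a0 mul0mx.
set q := (a *m a^T) 0 0; rewrite -!mulmxA [LHS]mulmxA -/a [LHS]mulmxA.
suff -> : a *m (q%:M - a^T *m a) = 0 by rewrite mul0mx.
by rewrite mulmxBr mulmxA [X in _ - X *m _]mx11_scalar scalar_mxC subrr.
Qed.

Lemma rational_approx n (b : 'I_n -> 'rV[R]_d) (N : {set 'I_n}) y :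
  (forall i, i \in N -> (b i *m y) 0 0 < 0) ->
  exists q : 'cV[rat]_d, forall i, i \in N -> (b i *m map_mx ratr q) 0 0 < 0.
Proof.
move=> by0.
(* [e] is a common margin, with 1 covering empty [N]. Moving each coordinate of [y] by at most
   [e / M] changes a value by at most [(M - 1) e / M < e]. *)
pose e := \big[Order.min/1]_(i in N) - (b i *m y) 0 0.
have e0 : 0 < e by apply: lt_bigmin => // i /by0; rewrite oppr_gt0.
pose M := 1 + \sum_i \sum_j `|b i 0 j|.
have S0 : 0 <= \sum_i \sum_j `|b i 0 j| :> R.
  by apply: sumr_ge0 => i _; apply: sumr_ge0.
have M0 : 0 < M by rewrite ltr_wpDr.
have /choice[q qP] j : exists q : rat, y j 0 < ratr q < y j 0 + e / M.
  have [|q] := @rat_in_itvoo R (y j 0) (y j 0 + e / M).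
    by rewrite ltrDl divr_gt0.
  by rewrite in_itv; exists q.
exists (\col_j q j) => i iN.
have -> : (b i *m map_mx ratr (\col_j q j)) 0 0 =
    (b i *m y) 0 0 + \sum_j b i 0 j * (ratr (q j) - y j 0).
  rewrite !mxE -big_split /=; apply: eq_bigr => j _.
  by rewrite !mxE -mulrDr subrKC.
apply: (@le_lt_trans _ _ (- e + (M - 1) * (e / M))); last first.
  rewrite mulrBl mul1r mulrCA divff ?gt_eqF // mulr1 addKr oppr_lt0.
  by rewrite divr_gt0.
apply: lerD.
  by rewrite lerNr; exact: (bigmin_le_cond _ (fun i => - (b i *m y) 0 0) iN).
rewrite /M addrC addKr mulr_suml (bigD1 i) //= -[leLHS]addr0 lerD //; last first.
  apply: sumr_ge0 => k _; apply: mulr_ge0; first by apply: sumr_ge0.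
  by rewrite ltW // divr_gt0.
rewrite mulr_suml; apply: ler_sum => j _.
rewrite (le_trans (ler_norm _)) // normrM ler_wpM2l //.
have /andP[q1 q2] := qP j.
by rewrite ger0_norm ?subr_ge0 ?ltW // ltrBlDl.
Qed.

End annihilator.

(** * Measurability of separation and of face counts *)

Section measurability.
Context {R : realType} {disp : measure_display} {T : measurableType disp}.

Definition measurable_mx m p (f : T -> 'M[R]_(m, p)) :=
  forall i j, measurable_fun setT (fun w => f w i j).

Lemma measurable_mx_mul m p q (f : T -> 'M[R]_(m, p)) (g : T -> 'M[R]_(p, q)) :
  measurable_mx f -> measurable_mx g -> measurable_mx (fun w => f w *m g w).
Proof.
move=> mf mg i j; under eq_fun do rewrite mxE.
by apply: measurable_sum => k; apply: measurable_funM; [exact: mf|exact: mg].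
Qed.

Lemma measurable_mx_tr m p (f : T -> 'M[R]_(m, p)) :
  measurable_mx f -> measurable_mx (fun w => (f w)^T).
Proof. by move=> mf i j; under eq_fun do rewrite mxE; exact: mf. Qed.

Lemma measurable_mx_cst m p (A : 'M[R]_(m, p)) : measurable_mx (fun _ => A).
Proof. by move=> i j; exact: measurable_cst. Qed.

Lemma measurable_ann_mx d n (v : 'I_n -> T -> 'rV[R]_d) (s : seq 'I_n) :
  (forall i, measurable_mx (v i)) ->
  measurable_mx (fun w => ann_mx [seq v i w | i <- s]).
Proof.
move=> mv; elim: s => [|x s IH] /=; first exact: measurable_mx_cst.
have ma := measurable_mx_mul (mv x) IH.
have mq := measurable_mx_mul ma (measurable_mx_tr ma).
move=> i j; under eq_fun do rewrite (fun_if (fun A : 'M[R]_d => A i j)).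
apply: measurable_fun_ifT; [|exact: IH|].
  by apply: measurable_fun_eqr; [exact: mq|exact: measurable_cst].
apply: measurable_mx_mul => // k l.
under eq_fun do rewrite mxE [X in X + _]mxE [X in _ + X]mxE.
apply: measurable_funB; last exact: (measurable_mx_mul (measurable_mx_tr ma) ma).
under eq_fun do rewrite -mulr_natr.
by apply: measurable_funM; [exact: mq|exact: measurable_cst].
Qed.

(** The equalities on [Z] would not survive rational approximation of [u]. Writing [u] as [ann_mx]
    times [y] solves them; only strict inequalities in [y] remain, so a countable union over
    rational [y] suffices. *)
Lemma measurable_separated d n (v : 'I_n -> T -> 'rV[R]_d) (Z N : {set 'I_n}) :
  (forall i, measurable_mx (v i)) ->
  measurable [set w | separated (v^~ w) Z N].
Proof.
move=> mv; pose b i w := v i w *m ann_mx [seq v i w | i <- enum Z].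
have mb i : measurable_mx (b i).
  by apply: measurable_mx_mul => //; exact: measurable_ann_mx.
rewrite (_ : [set w | _] = \bigcup_(q : 'cV[rat]_d) \bigcap_(i in [set` N])
    [set w | (b i w *m map_mx ratr q) 0 0 < 0]).
  apply: countable_bigcupT_measurable; first exact: countableP.
  move=> q; apply: fin_bigcap_measurable; first exact: finite_finset.
  move=> i _; rewrite -[X in measurable X]setTI.
  have mf : measurable_fun setT (fun w => (b i w *m map_mx ratr q) 0 0).
    by apply: measurable_mx_mul => //; exact: measurable_mx_cst.
  have := mf measurableT _ (measurable_itv `]-oo, 0[).
  by congr (measurable (_ `&` _)); apply/seteqP; split=> w /=; rewrite in_itv.
apply/seteqP; split=> w /=.
  move=> [u [uZ uN]].
  have [y uE] : exists y, u = ann_mx [seq v i w | i <- enum Z] *m y.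
    apply/ann_mxP => _ /mapP[i + ->]; rewrite mem_enum => iZ.
    by rewrite [LHS]mx11_scalar uZ // raddf0.
  have [|q qP] := @rational_approx R d n (b^~ w) N y.
    by move=> i iN; rewrite -mulmxA -uE uN.
  by exists q => // i /= iN; exact: qP.
move=> [q _ qP]; exists (ann_mx [seq v i w | i <- enum Z] *m map_mx ratr q).
split=> i iZ; last by rewrite mulmxA; exact: (qP i iZ).
have /ann_mxP -> : exists y, ann_mx [seq v i w | i <- enum Z] *m map_mx ratr q =
    ann_mx [seq v i w | i <- enum Z] *m y by eexists.
  by rewrite mxE.
by apply: map_f; rewrite mem_enum.
Qed.

Lemma measurable_forall_fin (I : finType) (F : I -> T -> Prop) :
  (forall i, measurable [set w | F i w]) -> measurable [set w | forall i, F i w].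
Proof.
move=> mF; rewrite (_ : [set w | _] = \bigcap_(i in setT) [set w | F i w]).
  by apply: fin_bigcap_measurable => //; exact: finite_finset.
by apply/seteqP; split=> w /= Fw i; [move=> _; exact: Fw|exact: Fw].
Qed.

Lemma measurable_exists_fin (I : finType) (F : I -> T -> Prop) :
  (forall i, measurable [set w | F i w]) -> measurable [set w | exists i, F i w].
Proof.
move=> mF; rewrite (_ : [set w | _] = \bigcup_(i in setT) [set w | F i w]).
  by apply: fin_bigcup_measurable => //; exact: finite_finset.
by apply/seteqP; split=> w /= [i] => [Fi|_ Fi]; exists i.
Qed.

Lemma measurable_imply (P : Prop) (F : T -> Prop) :
  measurable [set w | F w] -> measurable [set w | P -> F w].
Proof.
have [p mF|np _] := pselect P.
  by rewrite (_ : [set w | _] = [set w | F w]) //; apply/seteqP; split=> w /=; auto.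
by rewrite (_ : [set w | _] = setT) //; apply/seteqP; split=> w //= _ /np.
Qed.

Lemma measurable_faces d n (v : 'I_n -> T -> 'rV[R]_d) k (I : {set 'I_n}) :
  (forall i, measurable_mx (v i)) ->
  measurable [set w | I \in faces (v^~ w) k].
Proof.
move=> mv; have ms Z N := measurable_separated Z N mv.
rewrite (_ : [set w | _] = [set w | separated (v^~ w) I (~: I)] `&`
   [set w | exists B : {set 'I_n}, (B \subset I /\ #|B| = k) /\
    ((forall i, i \in B -> separated (v^~ w) (B :\ i) [set i]) /\
    (forall i, i \in I -> ~ separated (v^~ w) B [set i]))]).
  apply: measurableI => //; apply: measurable_exists_fin => B.
  have [BI|nBI] := pselect (B \subset I /\ #|B| = k); last first.
    by rewrite (_ : [set w | _] = set0) //; apply/seteqP; split=> w // -[].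
  rewrite (_ : [set w | _] =
    [set w | forall i, i \in B -> separated (v^~ w) (B :\ i) [set i]] `&`
    [set w | forall i, i \in I -> ~ separated (v^~ w) B [set i]]).
    apply: measurableI; apply: measurable_forall_fin => i;
      apply: measurable_imply => //.
    exact: measurableC (ms _ _).
  by apply/seteqP; split=> w /= => [[]|].
apply/seteqP; split=> w /=; rewrite finset.in_set.
  move=> /asboolP[sI /dim_sub_spanP[B [BI cB BZ BN]]]; split=> //.
  by exists B.
move=> [sI [B [[BI cB] [BZ BN]]]]; apply/asboolP; split=> //.
by apply/dim_sub_spanP; exists B.
Qed.

Lemma measurable_num_faces d n (v : 'I_n -> T -> 'rV[R]_d) k :
  (forall i, measurable_mx (v i)) ->
  measurable_fun setT (fun w => (num_faces k (pos_hull (v^~ w)))%:R : R).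
Proof.
move=> mv; rewrite (_ : (fun w => _) =
    fun w => \sum_(I : {set 'I_n}) \1_[set w | I \in faces (v^~ w) k] w).
  apply: measurable_sum => I; apply: measurable_indic.
  exact: measurable_faces.
apply/funext => w; rewrite num_facesE -sum1_card natr_sum big_mkcond /=.
apply: eq_bigr => I _; rewrite indicE; case: ifPn => H; first by rewrite mem_set.
by rewrite memNset //; exact/negP.
Qed.

End measurability.

(** * Face numbers of the walk cone as random variables *)

Section walk.
Context {R : realType} {disp : measure_display} {T : measurableType disp}.
Context {P : probability T R} {d n : nat}.
Variable xi : 'I_n -> {RV P >-> d.-tuple R}.

Lemma measurable_partial_sum i : measurable_mx (partial_sum xi i).
Proof.
move=> a c; rewrite (_ : (fun w => _) = fun w =>
    \sum_(j < n) if (j <= i)%N then tnth (xi j w) c else 0).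
  apply: measurable_sum => j; case: (j <= i)%N => //.
  apply: (@measurableT_comp _ _ _ _ _ _ (fun x : d.-tuple R => tnth x c)).
    exact: measurable_tnth.
  exact: measurable_funPT.
apply/funext => w; rewrite /partial_sum summxE big_mkcond.
by apply: eq_bigr => j _; case: ifP => // _; rewrite mxE.
Qed.

Lemma measurable_num_faces_walk k :
  measurable_fun setT (fun w => (num_faces k (walk_cone xi w))%:R : R).
Proof. exact/measurable_num_faces/measurable_partial_sum. Qed.

Lemma measurable_neighbourly k : measurable (neighbourly_event k xi).
Proof.
have := measurable_num_faces_walk k measurableT (measurable_set1 'C(n, k)%:R).
rewrite setTI; congr measurable; apply/seteqP; split=> w /=.
  by move=> /eqP; rewrite eqr_nat => /eqP.
by rewrite /neighbourly_event /= => ->.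
Qed.

(** Pointwise, the face number plus the indicator of the complementary event is at most [C(n, k)],
    as the face number is an integer bounded by it. *)
Lemma expectation_num_faces_le k :
  ('E_P[fun w => (num_faces k (walk_cone xi w))%:R] +
   P (~` neighbourly_event k xi) <= ('C(n, k)%:R)%:E)%E.
Proof.
have mA := measurableC (measurable_neighbourly k).
have mf := measurable_num_faces_walk k.
rewrite unlock -[~` _]setIT -integral_indic // -ge0_integralD //=; first last.
- exact/measurable_EFinP/measurable_indic.
- exact/measurable_EFinP.
have -> : ('C(n, k)%:R)%:E = (\int[P]_w (cst ('C(n, k)%:R)%:E w))%E :> \bar R.
  by rewrite integral_cst // [X in (_ * X)%E](probability_setT P) mule1.
apply: ge0_le_integral => //.
- by move=> w _; rewrite -EFinD lee_fin addr_ge0 // indicE.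
- apply: emeasurable_funD; first exact/measurable_EFinP.
  exact/measurable_EFinP/measurable_indic.
move=> w _; rewrite -EFinD lee_fin indicE.
have := num_faces_le (fun i => partial_sum xi i w) k.
rewrite -/(walk_cone xi w) leq_eqVlt => /predU1P[E|lt].
  by rewrite memNset ?E ?addr0 //; apply.
rewrite mem_set ?natr1 ?ler_nat // => /= E.
by rewrite E ltnn in lt.
Qed.

End walk.

(** * The probability estimate and its asymptotic forms *)

Theorem theorem4p3 (R : realType) (known : expected_num_faces_formula R)
  (k : nat) (n : nat -> nat) (n_ge : forall d, (d <= n d)%N)
  (disp : nat -> measure_display) (T : forall d, measurableType (disp d))
  (P : forall d, probability (T d) R)
  (xi : forall d, 'I_(n d) -> {RV (P d) >-> d.-tuple R})
  (xi_steps : forall d, (0 < d)%N -> walk_steps (xi d))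
  (n_le : \forall d \near \oo,
     (n d)%:R <= expR (d%:R / ((k%:R + 2^-1) * expR 1)) :> R) :
  (P d (neighbourly_event k (xi d)) @[d --> \oo] --> 1%E) /\
  (fun d => (1 - fine (P d (neighbourly_event k (xi d)))) : R^o) =O_\oo
  (fun d => ((n d)%:R `^ (- 2^-1)) : R^o).
Proof.
set s := (k%:R + 2^-1) * expR 1 : R.
set C := 2 * expR (s - 2^-1) : R.
(* Eventually [k < d <= n d], so the formula and the tail bounds apply; both claims follow from this
   estimate. *)
have bound : \forall d \near \oo,
    0 <= 1 - fine (P d (neighbourly_event k (xi d))) <=
    C * (n d)%:R `^ (- 2^-1).
  near=> d.
  have kd : (k < d)%N by near: d; exact: nbhs_infty_gt.
  have d0 : (0 < d)%N by exact: leq_ltn_trans kd.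
  have nd : (n d)%:R <= expR (d%:R / s) :> R by near: d.
  have n0 : (0 < n d)%N := leq_trans d0 (n_ge d).
  set A := neighbourly_event k (xi d).
  have mA : measurable A := measurable_neighbourly (xi d) k.
  have PA : P d A \is a fin_num by exact: fin_num_measure.
  have PC : P d (~` A) = (1 - fine (P d A))%:E.
    by rewrite probability_setC // EFinB fineK.
  apply/andP; split.
    by rewrite -lee_fin -PC.
  have := expectation_num_faces_le (xi d) k.
  rewrite (known _ _ _ _ _ _ _ kd (n_ge d) (xi_steps d d0)) -/A PC -EFinD lee_fin.
  rewrite addrC -lerBrDr => /le_trans; apply.
  apply: (le_trans (rstirling12_tail R (leq_trans kd (n_ge d)) (n_ge d))).
  exact: rstirling1_tail_le.
split.
  (* For a tolerance [e], [n d >= d >= e^(-2)] suffices. *)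
  have ninf : (n d)%:R `^ (- 2^-1) @[d --> \oo] --> (0 : R).
    apply/cvgrPdist_le => e e0; near=> d.
    have d0 : (0 < d)%N by near: d; exact: nbhs_infty_gt.
    have ed : e ^- 2 <= d%:R by near: d; exact: nbhs_infty_ger.
    rewrite sub0r normrN ger0_norm ?powR_ge0 //.
    rewrite -ler_sqr ?nnegrE ?powR_ge0 ?(ltW e0) // -powR_mulrn ?powR_ge0 //.
    rewrite -powRrM mulNr mulVf // powR_inv1 //.
    rewrite -[leRHS]invrK lef_pV2 ?posrE ?invr_gt0 ?exprn_gt0 //.
      by rewrite (le_trans ed) // ler_nat.
    by rewrite ltr0n (leq_trans d0).
  have fc : (1 - fine (P d (neighbourly_event k (xi d)))) @[d --> \oo] --> (0 : R).
    apply: (@squeeze_cvgr _ _ _ _ (cst 0) (fun d => C * (n d)%:R `^ (- 2^-1))).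
    - exact: bound.
    - exact: cvg_cst.
    - by rewrite -[X in _ --> X](mulr0 C); apply: cvgMr.
  have -> : (fun d => P d (neighbourly_event k (xi d))) =
     (fun d => (1 - (1 - fine (P d (neighbourly_event k (xi d)))))%:E).
    apply/funext => d; rewrite opprB addrC subrK fineK //.
    exact/fin_num_measure/measurable_neighbourly.
  apply: cvg_EFin; first by near=> d.
  rewrite -[X in _ --> X]subr0.
  by apply: cvgB fc; exact: cvg_cst.
(* Any [c >= C] serves as the constant. *)
apply/eqOP; near=> c; near=> d.
have /andP[f0 fC] : 0 <= 1 - fine (P d (neighbourly_event k (xi d))) <=
    C * (n d)%:R `^ (- 2^-1) by near: d.
rewrite ger0_norm // (le_trans fC) // ger0_norm ?powR_ge0 //.
rewrite ler_wpM2r ?powR_ge0 //.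
Unshelve. all: by end_near.
Qed.
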